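(* Let $q=p^r$ be a prime power ($p$ prime), let $M$ be chosen uniformly at random from $\mathrm{GL}(n,\mathbb{F}_q)$, and let $1\le k\le n$. For any elements $a_i\in\mathbb{F}_q$ indexed by the integers $1\le i\le k$ with $p\nmid i$, $$\left|\mathbb{P}_{M\in\mathrm{GL}(n,\mathbb{F}_q)}\big(\forall\,1\le i\le k \text{ with } p\nmid i:\ \mathrm{Tr}(M^i)=a_i\big)-\frac{1}{q^{k-\lfloor k/p\rfloor}}\right|\le\frac{(k+1)\,q^{\lfloor k/p\rfloor}}{q^n}.$$
   Context: ''Uniformly at random'' is Haar probability measure on the finite group $\mathrm{GL}(n,\mathbb{F}_q)$ of invertible $n\times n$ matrices over $\mathbb{F}_q$. *)

(* Defs.v *)
From HB Require Import structures.
From mathcomp Require Import all_boot all_order all_algebra all_field.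
Set Implicit Arguments. Unset Strict Implicit. Unset Printing Implicit Defensive.
Import Order.TTheory GRing.Theory Num.Theory.
Local Open Scope ring_scope.

Definition GLset (F : finFieldType) (n : nat) : {set 'M[F]_n} :=
  [set M : 'M[F]_n | M \in unitmx].

Definition trace_event (F : finFieldType) (n p k : nat) (a : nat -> F)
  : {set 'M[F]_n} :=
  [set M in GLset F n |
     [forall i : 'I_k.+1, ((0 < (i : nat))%N && ~~ (p %| i)%N) ==>
                          (\tr (M ^+ i) == a i)]].

Definition probGL (F : finFieldType) (n : nat) (E : {set 'M[F]_n}) : rat :=
  (#|E :&: GLset F n|%:R) / (#|GLset F n|%:R).

(* Main.v *)
Require Import Defs.
From HB Require Import structures.
From mathcomp Require Import all_boot all_order all_fingroup all_algebra all_field.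
From mathcomp Require Import zify ring lra.
Set Implicit Arguments. Unset Strict Implicit. Unset Printing Implicit Defensive.
Import Order.TTheory GRing.Theory Num.Theory.
Local Open Scope ring_scope.

(** Follow the first basis vector under M: the dimension d of the Krylov subspace it
    spans satisfies P(d = j) = (q^j - q^(j-1)) / (q^n - 1), and M is conjugate to a
    block triangular matrix whose blocks are a companion matrix C of size d with
    uniform last row (subject to invertibility) and an independent uniform element of
    GL(n - d).  By a Newton-type identity, Tr C^i is i times the i-th entry of the last
    row, counted from the end, plus a function of the previous ones.  Hence if d > k
    the traces Tr M^i with i <= k and p not dividing i are exactly uniform, while each
    d <= k contributes at most q^floor(k/p) / (q^n - 1) to the probability. *)

Lemma ltn_neq_ord_max d (i : 'I_d.+1) : i != ord_max -> (i < d)%N.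
Proof. by move=> im; rewrite ltn_neqAle -ltnS ltn_ord andbT. Qed.

(** * Traces of powers of matrices whose first rows are shifts *)

Section TraceCount.
Variable F : finFieldType.

(** Vectors are rows, acted on from the right: for [j < n] the orbit of the first basis vector
    starts with the first [j.+1] basis vectors. For [j = n > 0] the last row is forced to vanish. *)
Definition shift_rows n j (M : 'M[F]_n) :=
  [forall i : 'I_n, forall l : 'I_n, (i < j)%N ==> (M i l == (l == i.+1 :> nat)%:R)].

Lemma shift_rowsP n j (M : 'M[F]_n) :
  reflect (forall i l : 'I_n, (i < j)%N -> M i l = (l == i.+1 :> nat)%:R)
          (shift_rows j M).
Proof.
apply: (iffP forallP) => [H i l ij | H i].
  by have /forallP/(_ l)/implyP/(_ ij)/eqP := H i.
by apply/forallP => l; apply/implyP => ij; rewrite H.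
Qed.

Definition top_coef d h (v : 'rV[F]_d.+1) x :=
  (forall l : 'I_d.+1, (h < l)%N -> v 0 l = 0) /\ v 0 (inord h) = x.

(** Read [v] as a polynomial of degree at most [h]. Then [C] acts as multiplication by X, because
    its free last row only meets the coefficient at [d], which is zero. *)
Lemma top_coef_mul d h (v : 'rV[F]_d.+1) x (C : 'M_d.+1) :
  shift_rows d C -> (h < d)%N -> top_coef h v x -> top_coef h.+1 (v *m C) x.
Proof.
move=> /shift_rowsP hC hd [v0 vx].
have E (l : 'I_d.+1) : (h < l)%N -> (v *m C) 0 l = v 0 (inord l.-1).
  move=> hl; have ld := ltn_ord l; rewrite mxE (bigD1 (inord l.-1)) //= big1 => [|i].
    by rewrite hC inordK ?prednK ?eqxx ?mulr1 ?addr0 //; lia.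
  move=> il; have [ih|hi] := leqP i h; last by rewrite v0 ?mul0r.
  rewrite hC; last by lia.
  case: eqP => [li|]; last by rewrite mulr0.
  by move/eqP: il; case; apply: val_inj; rewrite /= inordK; lia.
split=> [l hl|]; first by rewrite E 1?ltnW // v0 // inordK; have := ltn_ord l; lia.
by rewrite E inordK.
Qed.

Lemma top_coef_expr d h (v : 'rV[F]_d.+1) x (C : 'M_d.+1) m :
  shift_rows d C -> (h + m <= d)%N -> top_coef h v x ->
  top_coef (h + m) (v *m C ^+ m) x.
Proof.
move=> hC; elim: m => [|m IH] hd vx; first by rewrite addn0 expr0 mulmx1.
rewrite addnS exprSr -mulmxE mulmxA; apply: top_coef_mul => //; first lia.
by apply: IH => //; lia.
Qed.

(* [C' - C] has rank one; telescope [C' ^+ i.+1 - C ^+ i.+1] and use that [C] and [C']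
   shift the coordinates of vectors that stay clear of the last one. *)
Lemma trX_sub_shift d (C C' : 'M[F]_d.+1) h i :
  shift_rows d C -> shift_rows d C' -> (h + i)%N = d ->
  (forall l : 'I_d.+1, (h < l)%N -> C' ord_max l = C ord_max l) ->
  \tr (C' ^+ i.+1) - \tr (C ^+ i.+1)
    = i.+1%:R * (C' ord_max (inord h) - C ord_max (inord h)).
Proof.
move=> hC hC' hi agree; pose u := row ord_max C' - row ord_max C.
have uE : C' - C = delta_mx ord_max 0 *m u.
  apply/matrixP=> i1 l; rewrite [RHS]mxE big_ord1 !mxE.
  have [->|ne] := eqVneq i1 ord_max; first by rewrite eqxx mul1r.
  have lt : (i1 < d)%N by apply: ltn_neq_ord_max.
  by rewrite (shift_rowsP _ _ hC i1) // (shift_rowsP _ _ hC' i1) // subrr mul0r.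
have tu : top_coef h u (C' ord_max (inord h) - C ord_max (inord h)).
  by split=> [l hl|]; rewrite !mxE // agree // subrr.
pose f s := \tr (C' ^+ s *m C ^+ (i.+1 - s)).
have -> : \tr (C' ^+ i.+1) - \tr (C ^+ i.+1) = f i.+1 - f 0%N.
  by rewrite /f subnn subn0 !expr0 mulmx1 mul1mx.
rewrite -(telescope_sumr f (leq0n _)) big_mkord.
rewrite (eq_bigr (fun=> C' ord_max (inord h) - C ord_max (inord h))).
  by rewrite sumr_const card_ord mulr_natl.
move=> s _; have sl := ltn_ord s; rewrite /f subSS subSn // exprSr exprS.
rewrite -raddfB /= -!mulmxE -mulmxA -mulmxBr -mulmxBl uE -(mulmxA (delta_mx _ _)).
rewrite mulmxA mxtrace_mulC mulmxA trace_mx11.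
rewrite -colE mxE.
have h1 : (h + (i - s) <= d)%N by lia.
have h2 : (h + (i - s) + s <= d)%N by lia.
have [_ <-] := top_coef_expr hC' h2 (top_coef_expr hC h1 tu).
by congr (_ _ _); apply: val_inj; rewrite /= inordK; lia.
Qed.

(* Off by one: [i] stands for the trace of the power [i.+1]. *)
Definition pinned (p k i : nat) := (i < k)%N && ~~ (p %| i.+1)%N.

(** * Companion matrices with prescribed traces *)

Definition trace_match n p k (a : nat -> F) (M : 'M[F]_n) :=
  [forall i : 'I_k.+1, ((0 < i)%N && ~~ (p %| i)%N) ==> (\tr (M ^+ i) == a i)].

Lemma trace_matchP n p k (a : nat -> F) (M : 'M[F]_n) :
  reflect (forall i, pinned p k i -> \tr (M ^+ i.+1) = a i.+1) (trace_match p k a M).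
Proof.
apply: (iffP forallP) => [H i /andP[ik pi] | H i].
  by have /implyP := H (Ordinal (ik : (i.+1 < k.+1)%N)); rewrite /= pi => /(_ isT)/eqP.
case: i => [[|i] ik] //=; apply/implyP => pi.
by rewrite H // /pinned pi andbT.
Qed.

(* The last row is read backwards, so that entry [i] of [g] governs the trace of the
   power [i.+1]. *)
Definition companion d (g : {ffun 'I_d.+1 -> F}) : 'M[F]_d.+1 :=
  \matrix_(i, l) if (i < d)%N then (l == i.+1 :> nat)%:R else g (rev_ord l).

Lemma companion_shift d g : shift_rows d (@companion d g).
Proof. by apply/shift_rowsP => i l id; rewrite mxE id. Qed.

Lemma companion_last d g l : @companion d g ord_max l = g (rev_ord l).
Proof. by rewrite mxE ltnn. Qed.

Lemma companion_inj d : injective (@companion d).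
Proof.
move=> g g' E; apply/ffunP => i.
by rewrite -(rev_ordK i) -!companion_last E.
Qed.

Lemma companion_onto d (C : 'M[F]_d.+1) : shift_rows d C ->
  C = companion [ffun i => C ord_max (rev_ord i)].
Proof.
move=> /shift_rowsP hC; apply/matrixP => i l; rewrite mxE ffunE rev_ordK.
case: ltnP => id; first by rewrite hC.
by congr (C _ _); apply: val_inj => /=; have := ltn_ord i; lia.
Qed.

(** Only the last entry of the first column can be nonzero; it is [g ord_max], which is the
    determinant up to sign. *)
Lemma companion_unit d (g : {ffun 'I_d.+1 -> F}) :
  (companion g \in unitmx) = (g ord_max != 0).
Proof.
have rev0 : rev_ord (ord0 : 'I_d.+1) = ord_max by apply: val_inj; rewrite /= subn1.
apply/idP/idP => [u | g0].
  apply/eqP => g0; have : companion g *m delta_mx 0 (0 : 'I_1) = 0.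
    rewrite -colE; apply/colP => i; rewrite !mxE.
    by case: ifP => //; rewrite rev0 g0.
  move/(canRL (mulKmx u)); rewrite mulmx0 => /matrixP/(_ 0 0).
  by rewrite !mxE !eqxx => /eqP; rewrite oner_eq0.
rewrite -row_free_unit; apply: inj_row_free => v vC.
have vS (i l : 'I_d.+1) : l = i.+1 :> nat -> v 0 i = - (v 0 ord_max * g (rev_ord l)).
  move=> li; have := congr1 (fun w : 'rV[F]_d.+1 => w 0 l) vC.
  rewrite !mxE (bigD1 ord_max) //= (bigD1 i) /=; last first.
    by apply/eqP => E; have := ltn_ord l; rewrite li E /=; lia.
  rewrite big1 ?addr0 => [|i1 /andP[i1m i1i]].
    rewrite companion_last mxE li eqxx ifT ?mulr1; last by have := ltn_ord l; lia.
    by move/eqP; rewrite addrC addr_eq0 => /eqP.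
  rewrite mxE li eqSS ifT ?(eq_sym (i : nat)) ?[(_ == _ :> nat)](negPf i1i) ?mulr0 //.
  exact: ltn_neq_ord_max.
have vm : v 0 ord_max = 0.
  have := congr1 (fun w : 'rV[F]_d.+1 => w 0 0) vC; rewrite !mxE (bigD1 ord_max) //= big1.
    by rewrite addr0 companion_last rev0 => /eqP; rewrite mulf_eq0 (negPf g0) orbF => /eqP.
  move=> i1 i1m; rewrite mxE ifT ?mulr0 //.
  exact: ltn_neq_ord_max.
apply/rowP => i; rewrite [RHS]mxE; have [->//|im] := eqVneq i ord_max.
have id : (i.+1 < d.+1)%N.
  exact: ltn_neq_ord_max.
by rewrite (vS i (Ordinal id)) // vm mul0r oppr0.
Qed.

Definition shift_count n p k j (a : nat -> F) :=
  #|[set M : 'M[F]_n | [&& M \in unitmx, shift_rows j M & trace_match p k a M]]|.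

Lemma companion_count d p k (a : nat -> F) :
  shift_count d.+1 p k d a = #|[set g : {ffun 'I_d.+1 -> F} |
     (g ord_max != 0) && trace_match p k a (companion g)]|.
Proof.
rewrite -(card_imset _ (@companion_inj d)); apply: eq_card => C.
apply/idP/imsetP => [|[g]].
  rewrite inE => /and3P[uC sC mC]; exists [ffun i => C ord_max (rev_ord i)].
    by rewrite inE -companion_unit -companion_onto // uC.
  exact: companion_onto.
by rewrite !inE => /andP[g0 mg] ->; rewrite companion_unit g0 companion_shift.
Qed.

(** A change of coordinates that turns trace conditions into conditions on single coordinates, so
    that solutions are counted as a product set. *)
Definition newton_map p k d (g : {ffun 'I_d.+1 -> F}) : {ffun 'I_d.+1 -> F} :=
  [ffun i : 'I_d.+1 => if pinned p k i then \tr (companion g ^+ i.+1) else g i].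

(** The map is triangular: once the entries before [i] agree, the traces of the power [i.+1] differ
    by [i.+1] times the difference of the entries at [i], and [i.+1] is a unit in [F] when [i] is
    pinned. *)
Lemma newton_map_inj p k d : p \in [pchar F] -> injective (@newton_map p k d).
Proof.
move=> pF g g' E.
suff H i (id : (i < d.+1)%N) : g (Ordinal id) = g' (Ordinal id).
  by apply/ffunP => -[i id].
elim/ltn_ind: i id => i IH id.
have := congr1 (fun f : {ffun _ -> F} => f (Ordinal id)) E; rewrite !ffunE /=.
case: ifP => // /andP[ik pi] /eqP; rewrite -subr_eq0.
rewrite (trX_sub_shift (h := (d - i)%N) (companion_shift g') (companion_shift g)).
- rewrite mulf_eq0 -(dvdn_pcharf pF) (negPf pi) /= !companion_last subr_eq0.
  have -> : rev_ord (inord (d - i)) = Ordinal id :> 'I_d.+1.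
    by apply: val_inj; rewrite /= inordK; lia.
  by move/eqP.
- by lia.
move=> l dl; rewrite !companion_last.
have ri : (rev_ord l < i)%N by rewrite /=; have := ltn_ord l; lia.
have -> : rev_ord l = Ordinal (ltn_ord (rev_ord l)) by apply: val_inj.
exact: IH.
Qed.

Lemma sum_dvdnS p n : (0 < p)%N -> (\sum_(i < n) (p %| i.+1) = n %/ p)%N.
Proof.
move=> p0; elim: n => [|n IH]; first by rewrite big_ord0 div0n.
by rewrite big_ord_recr /= IH divnS // addnC.
Qed.

Lemma prod_unpinned p k n (q : nat) : (0 < p)%N ->
  (\prod_(i < n) (if pinned p k i then 1 else q) = q ^ (minn n k %/ p + (n - k)))%N.
Proof.
move=> p0; elim: n => [|n IH]; first by rewrite big_ord0 min0n div0n sub0n.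
rewrite big_ord_recr /= IH /pinned; case: ltnP => nk /=.
  rewrite (minn_idPl nk) divnS //.
  have -> : (n.+1 - k = 0)%N by lia.
  have -> : (n - k = 0)%N by lia.
  by case: (p %| n.+1)%N; rewrite /= ?muln1 // !addn0 add1n expnSr.
rewrite (minn_idPr (leqW nk)) subSn // addnS expnSr //.
Qed.

(** The last entry, which decides invertibility, may itself be fixed by the traces; the condition on
    it is dropped, which leaves only a bound. *)
Lemma companion_count_le d p k (a : nat -> F) : prime p -> p \in [pchar F] -> (d < k)%N ->
  (shift_count d.+1 p k d a <= #|F| ^ (k %/ p))%N.
Proof.
move=> pp pF dk; have p0 := prime_gt0 pp; rewrite companion_count.
pose R (i : 'I_d.+1) : pred F := if pinned p k i then pred1 (a i.+1) else predT.
have -> : (k %/ p = k %/ p + 0)%N by rewrite addn0.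
apply: (@leq_trans #|@newton_map p k d @^-1: [set g in family R]|).
  apply/subset_leq_card/subsetP => g; rewrite !inE => /andP[_ /trace_matchP m].
  apply/familyP => i; rewrite ffunE /R; case: ifP => // pi.
  by rewrite inE m.
rewrite card_preimset; last exact: newton_map_inj.
rewrite cardsE card_family foldrE big_map big_enum /=.
rewrite (eq_bigr (fun i : 'I_d.+1 => if pinned p k i then 1%N else #|F|)).
  rewrite prod_unpinned // leq_exp2l ?finNzRing_gt1 //.
  have -> : (d.+1 - k = 0)%N by lia.
  by rewrite leq_add2r leq_div2r // geq_minr.
by move=> i _; rewrite /R; case: ifP => _; rewrite ?card1.
Qed.

(** Here the last entry is not pinned, so invertibility is independent of the traces and contributes
    the factor [#|F| - 1]. *)
Lemma companion_count_eq d p k (a : nat -> F) : prime p -> p \in [pchar F] -> (k <= d)%N ->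
  (shift_count d.+1 p k d a = (#|F| - 1) * #|F| ^ (k %/ p + (d - k)))%N.
Proof.
move=> pp pF kd; have p0 := prime_gt0 pp; rewrite companion_count.
pose R (i : 'I_d.+1) : pred F :=
  if i == ord_max then predC1 0 else if pinned p k i then pred1 (a i.+1) else predT.
have npin : pinned p k (ord_max : 'I_d.+1) = false by rewrite /pinned /= ltnNge kd.
transitivity #|@newton_map p k d @^-1: [set g in family R]|.
  apply: eq_card => g; rewrite !inE.
  apply/andP/familyP => [[g0 /trace_matchP m] i | H].
    rewrite ffunE /R; case: eqP => [->|_]; first by rewrite npin !inE.
    by case: ifP => // pi; rewrite inE m.
  have g0 : g ord_max != 0 by have := H ord_max; rewrite ffunE npin /R eqxx !inE.
  split=> //; apply/trace_matchP => i pi.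
  have id : (i < d.+1)%N by case/andP: pi => ik _; lia.
  have := H (Ordinal id); rewrite ffunE /R -val_eqE /= pi; case: eqP => [E|_].
    by move: pi; rewrite E npin.
  by rewrite inE => /eqP.
rewrite card_preimset; last exact: newton_map_inj.
rewrite cardsE card_family foldrE big_map big_enum /= big_ord_recr /= mulnC.
congr (_ * _)%N; first by rewrite /R eqxx cardC1 subn1.
rewrite (eq_bigr (fun i : 'I_d => if pinned p k i then 1%N else #|F|)).
  by rewrite prod_unpinned // (minn_idPr kd).
move=> i _; rewrite /R -val_eqE /= ltn_eqF //.
by case: ifP => _; rewrite ?card1.
Qed.

(** * Splitting off a companion block, or gaining one more shift row *)

Lemma shift_rows_rowP n j (M : 'M[F]_n) : (j < n)%N ->
  reflect (forall i i' : 'I_n, (i < j)%N -> i' = i.+1 :> nat -> row i M = delta_mx 0 i')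
          (shift_rows j M).
Proof.
move=> jn; apply: (iffP (shift_rowsP _ _)) => [H i i' ij E | H i l ij].
  by apply/rowP => l; rewrite !mxE H // -E.
have i'n : (i.+1 < n)%N by lia.
by have /rowP/(_ l) := H i (Ordinal i'n) ij erefl; rewrite !mxE.
Qed.

Lemma trX_lblock n1 n2 (A : 'M[F]_n1) (X : 'M_(n2, n1)) (B : 'M_n2) i :
  \tr (block_mx A 0 X B ^+ i) = \tr (A ^+ i) + \tr (B ^+ i).
Proof.
suff [Y ->] : exists Y, block_mx A 0 X B ^+ i = block_mx (A ^+ i) 0 Y (B ^+ i).
  exact: mxtrace_block.
elim: i => [|i [Y E]]; first by exists 0; rewrite !expr0 -scalar_mx_block.
exists (X *m A ^+ i + B *m Y).
by rewrite !exprS E -mulmxE mulmx_block !mul0mx !mulmx0 !addr0 add0r.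
Qed.

Lemma trX_conjmx n (P M : 'M[F]_n) i : P \in unitmx ->
  \tr ((P *m M *m invmx P) ^+ i) = \tr (M ^+ i).
Proof.
move=> uP; suff -> : (P *m M *m invmx P) ^+ i = P *m M ^+ i *m invmx P.
  by rewrite mxtrace_mulC mulmxA mulVmx // mul1mx.
elim: i => [|i IH]; first by rewrite !expr0 mulmx1 mulmxV.
by rewrite !exprS IH -!mulmxE !mulmxA mulmxKV.
Qed.

Lemma shift_rows_lblock j m (C : 'M[F]_j.+1) (X : 'M_(m, j.+1)) (B : 'M_m) :
  shift_rows j (block_mx C 0 X B) = shift_rows j C.
Proof.
apply/shift_rowsP/shift_rowsP => H i l ij.
  by have := H (lshift m i) (lshift m l) ij; rewrite block_mxEul.
case: (split_ordP i) ij => {}i -> /= ij; last by lia.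
case: (split_ordP l) => {}l -> /=; first by rewrite block_mxEul H.
by rewrite block_mxEur mxE gtn_eqF //; lia.
Qed.

(** Rows before [j] have their entry 1 within the first [j.+1] columns, so only row [j] can leave
    the span of the first [j.+1] basis vectors. *)
Lemma ursubmx_shift j m (M : 'M[F]_(j.+1 + m)) : shift_rows j M ->
  (ursubmx M == 0) = (rsubmx (row (lshift m ord_max) M) == 0).
Proof.
move=> /shift_rowsP hM; apply/eqP/eqP => [/matrixP E | /rowP E].
  by apply/rowP => l; have := E ord_max l; rewrite !mxE.
apply/matrixP => i l; rewrite !mxE; have [->|im] := eqVneq i ord_max.
  by have := E l; rewrite !mxE.
have ij := ltn_neq_ord_max im.
by rewrite hM // gtn_eqF //= ; lia.
Qed.

Lemma card_row_outside j m :
  #|[set w : 'rV[F]_(j + m) | rsubmx w != 0]| = (#|F| ^ (j + m) - #|F| ^ j)%N.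
Proof.
have -> : [set w : 'rV[F]_(j + m) | rsubmx w != 0] =
    ~: [set row_mx v 0 | v : 'rV[F]_j].
  apply/setP => w; rewrite !inE; congr (~~ _).
  apply/eqP/imsetP => [E | [v _ ->]]; last exact: row_mxKr.
  by exists (lsubmx w); rewrite // -E hsubmxK.
rewrite cardsCs setCK card_mx mul1n card_imset ?card_mx ?mul1n //.
by move=> u v /eq_row_mx[].
Qed.

(** Traces add over the diagonal blocks, so [B] shifts the targets for [C]; the lower left block is
    free. *)
Lemma card_block_reduction j m p k (a : nat -> F) :
  #|[set M : 'M[F]_(j.+1 + m) | [&& M \in unitmx, shift_rows j M & trace_match p k a M]]
     :&: [set M | ursubmx M == 0]|
  = (\sum_(B in GLset F m) #|F| ^ (m * j.+1) *
       shift_count j.+1 p k j (fun i => (a i - \tr (B ^+ i))%R))%N.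
Proof.
pose f (t : 'M[F]_m * ('M[F]_(m, j.+1) * 'M[F]_j.+1)) := block_mx t.2.2 0 t.2.1 t.1.
pose good (B : 'M[F]_m) := [set C : 'M[F]_j.+1 | [&& C \in unitmx, shift_rows j C &
                  trace_match p k (fun i => a i - \tr (B ^+ i)) C]].
have fE B X C : (f (B, (X, C)) \in [set M : 'M[F]_(j.+1 + m) |
      [&& M \in unitmx, shift_rows j M & trace_match p k a M]])
    = (B \in GLset F m) && (C \in good B).
  rewrite !inE shift_rows_lblock unitmxE det_lblock unitrM -!unitmxE.
  rewrite [(C \in _) && _]andbC -!andbA; congr [&& _, _, _ & _].
  apply/trace_matchP/trace_matchP => H i /H; rewrite trX_lblock => E.
    by rewrite -E addrK.
  by rewrite E subrK.
have finj : injective f.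
  by move=> [B [X C]] [B' [X' C']] /eq_block_mx[/= -> _ -> ->].
transitivity #|[set t : 'M[F]_m * ('M[F]_(m, j.+1) * 'M[F]_j.+1) |
    (t.1 \in GLset F m) && (t.2.2 \in good t.1)]|.
  rewrite -(card_imset _ finj); apply: eq_card => M.
  apply/idP/imsetP => [|[[B [X C]]]].
    rewrite inE [X in _ && X]inE => /andP[hM /eqP ur].
    have E : M = f (drsubmx M, (dlsubmx M, ulsubmx M)) by rewrite /f -ur submxK.
    by exists (drsubmx M, (dlsubmx M, ulsubmx M)); rewrite // inE /= -(fE _ (dlsubmx M)) -E.
  rewrite inE /= -(fE _ X) => h ->; rewrite inE h.
  by rewrite inE /f block_mxKur eqxx.
rewrite -sum1_card
  (eq_bigl (fun t => (t.1 \in GLset F m) && (t.2.2 \in good t.1))); last first.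
  by move=> t; rewrite inE.
rewrite -(pair_big_dep (mem (GLset F m))
  (fun B (u : _ * _) => u.2 \in good B) (fun _ _ => 1%N)).
apply: eq_bigr => B _ /=.
rewrite -(pair_big predT (mem (good B)) (fun _ _ => 1%N)) /=.
by rewrite sum1_card sum_nat_const card_mx.
Qed.

(** Completes the first [j.+1] basis vectors and [w] to a basis: in the identity, replace by [w] a
    row [l0] past index [j] at which [w] has a nonzero entry, then swap it into position [j.+1]. *)
Lemma exists_unit_rows j m (w : 'rV[F]_(j.+1 + m.+1)) : rsubmx w != 0 ->
  exists2 P : 'M_(j.+1 + m.+1), P \in unitmx &
    (forall i : 'I_(j.+1 + m.+1), (i <= j)%N -> row i P = delta_mx 0 i) /\
    row (rshift j.+1 ord0) P = w.
Proof.
move=> w0; have [l wl] : exists l, rsubmx w 0 l != 0.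
  apply/existsP; apply: contraNT w0; rewrite negb_exists => /forallP H.
  by apply/eqP/rowP => l; rewrite [RHS]mxE; have := H l; rewrite negbK => /eqP.
rewrite mxE in wl; set l0 := rshift _ _ in wl.
pose P0 : 'M[F]_(j.+1 + m.+1) := \matrix_(i, c) if i == l0 then w 0 c else (i == c)%:R.
have uP0 : P0 \in unitmx.
  rewrite -row_free_unit; apply: inj_row_free => v vP.
  have vc c : v 0 l0 * w 0 c + (if c == l0 then 0 else v 0 c) = 0.
    have := congr1 (fun u : 'rV[F]_(j.+1 + m.+1) => u 0 c) vP.
    rewrite !mxE (bigD1 l0) //= mxE eqxx => E; rewrite -[RHS]E {E}; congr (_ + _).
    case: ifP => [/eqP -> | /negbT cl].
      by rewrite big1 // => i /negPf il; rewrite mxE il mulr0.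
    rewrite (bigD1 c) //= mxE (negPf cl) eqxx mulr1 big1 ?addr0 //.
    move=> i /andP[/negPf il /negPf ic].
    by rewrite mxE il ic mulr0.
  have vl : v 0 l0 = 0.
    have := vc l0; rewrite eqxx addr0 => /eqP.
    by rewrite mulf_eq0 (negPf wl) orbF => /eqP.
  apply/rowP => c; rewrite [RHS]mxE; have := vc c; rewrite vl mul0r add0r.
  by case: eqP => // ->.
exists (xrow (rshift j.+1 ord0) l0 P0).
  by rewrite xrowE unitmx_mul unitmx_perm.
have rowx i : row i (xrow (rshift j.+1 ord0) l0 P0) = row (tperm (rshift j.+1 ord0) l0 i) P0.
  by apply/rowP => c; rewrite !mxE.
split=> [i ij|].
  have [i1 i2] : i != rshift j.+1 ord0 /\ i != l0.
    by split; apply/eqP => E; move: ij; rewrite E /=; lia.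
  rewrite rowx tpermD 1?eq_sym //; apply/rowP => c; rewrite !mxE (negPf i2) eqxx.
  by rewrite eq_sym.
by rewrite rowx tpermL; apply/rowP => c; rewrite !mxE eqxx.
Qed.

(** In the basis formed by the rows of [P], the condition that row [j] is [w] becomes the next shift
    condition. Conjugation preserves traces and invertibility, so the count does not depend on
    [w]. *)
Lemma card_row_fiber j m p k (a : nat -> F) (w : 'rV[F]_(j.+1 + m)) : rsubmx w != 0 ->
  #|[set M : 'M[F]_(j.+1 + m) | [&& M \in unitmx, shift_rows j M & trace_match p k a M]]
    :&: [set M | row (lshift m ord_max) M == w]| = shift_count (j.+1 + m) p k j.+1 a.
Proof.
case: m w => [|m] w w0; first by rewrite [rsubmx w]thinmx0 eqxx in w0.
have [P uP [Pd Pw]] := exists_unit_rows w0.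
pose f (M : 'M[F]_(j.+1 + m.+1)) := P *m M *m invmx P.
have finj : injective f.
  by move=> M N /(can_inj (mulmxKV uP))/(can_inj (mulKmx uP)).
rewrite /shift_count -[RHS](card_preimset _ finj); apply: eq_card => M.
rewrite !inE !unitmx_mul unitmx_inv uP andbT /=.
have -> : trace_match p k a (f M) = trace_match p k a M.
  by apply: eq_forallb => i; rewrite trX_conjmx.
rewrite -!andbA; congr (_ && _); rewrite [trace_match _ _ _ _ && _]andbC andbA; congr (_ && _).
(* For [i <= j] row [i] of [P] is a basis vector, so conjugation affects row [i] of [M] only through
   right multiplication by [invmx P]. *)
have rowf (i i' : 'I_(j.+1 + m.+1)) : (i <= j)%N ->
    (row i (f M) == delta_mx 0 i') = (row i M == row i' P).
  move=> ij; rewrite /f !row_mul (Pd i) // -rowE.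
  rewrite -(inj_eq (can_inj (mulmxK uP))) mulmxKV // -rowE //.
have jn : (j < j.+1 + m.+1)%N by lia.
have jn1 : (j.+1 < j.+1 + m.+1)%N by lia.
apply/andP/(shift_rows_rowP _ jn1) => [[/(shift_rows_rowP _ jn) H /eqP Hw] i i' ij E | H].
  apply/eqP; rewrite rowf //; move: ij; rewrite ltnS leq_eqVlt => /predU1P[ij|ij].
    have -> : i = lshift m.+1 ord_max by apply: val_inj.
    have -> : i' = rshift j.+1 ord0 by apply: val_inj; rewrite /= addn0 E ij.
    by rewrite Hw Pw.
  by rewrite (H i i') // Pd // E.
split.
  apply/(shift_rows_rowP _ jn) => i i' ij E.
  by rewrite -Pd ?E //; apply/eqP; rewrite -rowf ?(ltnW ij) //; apply/eqP/H => //; apply: ltnW.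
rewrite -Pw -rowf //; apply/eqP; apply: H => //=.
by rewrite addn0.
Qed.

(* The row of index [j] is either a combination of the first [j.+1] basis vectors,
   and the matrix is block triangular, or it can be moved to the next basis vector
   by a conjugation that fixes those. *)
Lemma shift_count_step j m p k (a : nat -> F) :
  shift_count (j.+1 + m) p k j a =
    (\sum_(B in GLset F m) #|F| ^ (m * j.+1) *
       shift_count j.+1 p k j (fun i => (a i - \tr (B ^+ i))%R)
     + (#|F| ^ (j.+1 + m) - #|F| ^ j.+1) * shift_count (j.+1 + m) p k j.+1 a)%N.
Proof.
rewrite {1}/shift_count -(cardsID [set M | ursubmx M == 0]) card_block_reduction.
congr (_ + _)%N.
rewrite -card_row_outside -sum_nat_const -sum1_card.
rewrite (partition_big (row (lshift m ord_max)) (mem [set w | rsubmx w != 0])) /=.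
  apply: eq_bigr => w; rewrite inE => w0; rewrite -(card_row_fiber _ _ _ w0) -sum1_card.
  apply: eq_bigl => M; rewrite !inE.
  case: (boolP [&& M \in unitmx, _ & _]) => [/and3P[_ sM _]|_]; last by rewrite !andbF.
  by rewrite !andbT ursubmx_shift //; case: (row _ _ =P w) => [->|_]; rewrite ?w0 ?andbF.
by move=> M; rewrite !inE => /andP[ur /and3P[_ sM _]]; rewrite -ursubmx_shift.
Qed.

(** * Orders of general linear groups *)

Local Notation q := #|F|.

Lemma card_GLset n :
  #|GLset F n| = (q ^ 'C(n, 2) * \prod_(1 <= i < n.+1) (q ^ i - 1))%N.
Proof.
case: n => [|n].
  rewrite big_geq // muln1 (@eq_card1 _ 0) // => M.
  by rewrite [M]flatmx0 !inE unitmxE det_mx00 unitr1 eqxx.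
rewrite -card_GL // cardsT /= card_sub; apply: eq_card => M.
by rewrite inE.
Qed.

Lemma card_GLsetS n : #|GLset F n.+1| = ((q ^ n.+1 - 1) * q ^ n * #|GLset F n|)%N.
Proof.
rewrite !card_GLset binS bin1 expnD big_nat_recr //=.
by rewrite mulnACA [LHS]mulnC [(_ ^ n * _)%N]mulnC.
Qed.

(* The number of invertible matrices with [j] prescribed independent rows. *)
Definition GL_tail n j := (q ^ ((n - j) * j) * #|GLset F (n - j)|)%N.

Lemma GL_tail0 n : GL_tail n 0 = #|GLset F n|.
Proof. by rewrite /GL_tail muln0 subn0 mul1n. Qed.

Lemma GL_tail_gt0 n j : (0 < GL_tail n j)%N.
Proof.
rewrite muln_gt0 expn_gt0 (ltnW (finNzRing_gt1 F)) /=.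
by apply/card_gt0P; exists 1%:M; rewrite inE unitmx1.
Qed.

(** The next row must avoid the span of the [j] rows already fixed. *)
Lemma GL_tailS n j : (j < n)%N -> GL_tail n j = ((q ^ n - q ^ j) * GL_tail n j.+1)%N.
Proof.
move=> jn; rewrite /GL_tail; set m := (n - j.+1)%N.
have -> : (n - j = m.+1)%N by lia.
have -> : (q ^ n = q ^ j * q ^ m.+1)%N by rewrite -expnD; congr (_ ^ _)%N; lia.
rewrite -{2}[(q ^ j)%N]muln1 -mulnBr card_GLsetS mulSn mulnS !expnD.
by rewrite -!mulnA; congr (_ * _)%N; rewrite mulnCA; congr (_ * _)%N; rewrite mulnCA.
Qed.

(** * Recursion on the number of shift rows *)

Section Trace.
Variables p k : nat.
Hypotheses (p_prime : prime p) (p_char : p \in [pchar F]).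

(** The companion count does not depend on the targets, so the traces of [B] drop out of the sum. *)
Lemma shift_count_eq n j (a : nat -> F) : (k <= j)%N -> (j < n)%N ->
  shift_count n p k j a = ((q - 1) * q ^ (k %/ p + (j - k)) * GL_tail n j.+1
    + (q ^ n - q ^ j.+1) * shift_count n p k j.+1 a)%N.
Proof.
move=> kj jn; have [m ->] : exists m, n = (j.+1 + m)%N by exists (n - j.+1)%N; lia.
rewrite shift_count_step; congr (_ + _)%N.
under eq_bigr do rewrite companion_count_eq //.
by rewrite sum_nat_const /GL_tail addKn; ring.
Qed.

Lemma shift_count_le n j (a : nat -> F) : (j < k)%N -> (j < n)%N ->
  exists2 c, (c <= q ^ (k %/ p) * GL_tail n j.+1)%N &
    shift_count n p k j a = (c + (q ^ n - q ^ j.+1) * shift_count n p k j.+1 a)%N.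
Proof.
move=> jk jn; have [m ->] : exists m, n = (j.+1 + m)%N by exists (n - j.+1)%N; lia.
rewrite shift_count_step; eexists; last by [].
rewrite /GL_tail addKn.
rewrite [X in (_ <= X)%N](_ : _ = \sum_(B in GLset F m) q ^ (m * j.+1) * q ^ (k %/ p))%N.
  by apply: leq_sum => B _; rewrite leq_mul2l companion_count_le ?orbT.
by rewrite sum_nat_const; ring.
Qed.

(** Descending induction on [j]: every companion block split off from here on has size above [k], so
    each term of the recursion carries the exact proportion [1 / q ^ (k - k %/ p)]. *)
Lemma shift_count_uniform n j (a : nat -> F) : (k <= j)%N -> (j < n)%N ->
  (shift_count n p k j a * q ^ (k - k %/ p) = GL_tail n j)%N.
Proof.
have q1 := finNzRing_gt1 F.
move: {2}(n - j)%N (leqnn (n - j)) => r; elim: r j => [|r IH] j nr kj jn; first by lia.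
rewrite (shift_count_eq a kj jn) (GL_tailS jn) mulnDl -mulnA.
have -> : (GL_tail n j.+1 * q ^ (k - k %/ p) = q ^ (k - k %/ p) * GL_tail n j.+1)%N.
  by rewrite mulnC.
rewrite mulnA -[((q - 1) * _ * _)%N]mulnA -expnD.
(* The block terms now contribute [(q - 1) * q ^ j], exactly what [q ^ n - q ^ j.+1] lacks to reach
   [q ^ n - q ^ j]. *)
have -> : (k %/ p + (j - k) + (k - k %/ p) = j)%N by have := leq_div k p; lia.
rewrite -[X in (_ + X)%N]mulnA.
have -> : ((q ^ n - q ^ j.+1) * (shift_count n p k j.+1 a * q ^ (k - k %/ p)) =
           (q ^ n - q ^ j.+1) * GL_tail n j.+1)%N.
  (* For [j.+1 = n] the induction hypothesis does not apply, but the factor [q ^ n - q ^ j.+1] is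
     zero. *)
  have [jn1|nj] := ltnP j.+1 n.
    by rewrite IH //; [lia | apply: leqW].
  by rewrite (_ : n = j.+1) ?subnn //; lia.
rewrite -mulnDl; congr (_ * _)%N; rewrite mulnBl mul1n -expnS.
have : (q ^ j.+1 <= q ^ n)%N by rewrite leq_exp2l.
have : (q ^ j <= q ^ j.+1)%N by rewrite leq_exp2l.
lia.
Qed.

(** For [j < n] this is [q ^ n - q ^ j] times the proportion of matrices with the required traces
    among the invertible ones with [j] shift rows. By [GL_tailS] this factor makes the recursion
    additive. *)
Definition shift_ratio n (a : nat -> F) j : rat :=
  (q ^ n - q ^ j)%N%:R * (shift_count n p k j a)%:R / (GL_tail n j)%:R.

Lemma shift_ratio_step n (a : nat -> F) j : (j < k)%N -> (j < n)%N ->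
  shift_ratio n a j.+1 <= shift_ratio n a j <= shift_ratio n a j.+1 + (q ^ (k %/ p))%N%:R.
Proof.
move=> jk jn; have [c cle E] := shift_count_le a jk jn.
have q1 := finNzRing_gt1 F.
have D0 : 0 < (GL_tail n j.+1)%:R :> rat by rewrite ltr0n GL_tail_gt0.
have Q0 : (q ^ n - q ^ j)%N%:R != 0 :> rat.
  by rewrite pnatr_eq0 subn_eq0 -ltnNge ltn_exp2l.
have -> : shift_ratio n a j = c%:R / (GL_tail n j.+1)%:R + shift_ratio n a j.+1.
  rewrite /shift_ratio GL_tailS // !natrM invfM mulrACA mulfV // mul1r E natrD natrM.
  by rewrite mulrDl.
rewrite lerDr divr_ge0 ?ler0n //= addrC lerD2l ler_pdivrMr // -natrM ler_nat //.
Qed.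

Lemma shift_ratio_top n (a : nat -> F) : (k <= n)%N ->
  shift_ratio n a k = (q ^ n - q ^ k)%N%:R / (q ^ (k - k %/ p))%N%:R.
Proof.
rewrite leq_eqVlt => /predU1P[<-|kn]; first by rewrite /shift_ratio subnn !mul0r.
rewrite /shift_ratio -(shift_count_uniform a (leqnn k) kn) natrM -mulrA; congr (_ * _).
have : GL_tail n k != 0%N by rewrite -lt0n GL_tail_gt0.
rewrite -(shift_count_uniform a (leqnn k) kn) muln_eq0 negb_or => /andP[N0 _].
by rewrite invfM mulrA divff ?mul1r ?pnatr_eq0.
Qed.

Lemma shift_ratio_bounds n (a : nat -> F) : (k <= n)%N ->
  shift_ratio n a k <= shift_ratio n a 0
    <= shift_ratio n a k + k%:R * (q ^ (k %/ p))%N%:R.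
Proof.
move=> kn; suff H i : (i <= k)%N -> shift_ratio n a k <= shift_ratio n a (k - i)
    <= shift_ratio n a k + i%:R * (q ^ (k %/ p))%N%:R.
  by have := H k (leqnn k); rewrite subnn.
elim: i => [|i IH] ik; first by rewrite subn0 mul0r addr0 lexx.
have /andP[l1 l2] := IH (ltnW ik).
have jk : (k - i.+1 < k)%N by lia.
have := @shift_ratio_step n a _ jk (leq_trans jk kn).
rewrite (_ : (k - i.+1).+1 = k - i)%N; last by lia.
move=> /andP[l3 l4]; rewrite (le_trans l1 l3) /= -natr1 mulrDl mul1r addrA.
by apply: le_trans l4 _; rewrite lerD2r.
Qed.

Lemma probGL_trace n (a : nat -> F) :
  (q ^ n - 1)%N%:R * probGL (trace_event n p k a) = shift_ratio n a 0.
Proof.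
rewrite /shift_ratio /probGL GL_tail0 expn0 mulrA; congr (_ * _%:R / _).
apply: eq_card => M; rewrite !inE /trace_match.
have -> : shift_rows 0 M by apply/shift_rowsP.
by case: (M \in unitmx); rewrite ?andbT ?andbF.
Qed.

End Trace.
End TraceCount.

(** * From the ratio bounds to the deviation of the probability *)

(** To be used with [Q = q ^ n], [S = q ^ (k %/ p)], [K = k] and [m = q ^ (k - k %/ p)], so that
    [m * S = q ^ k]. As [0 < m^-1 <= 1 <= S], the bounds put [(Q - 1) * (P - m^-1)] between [- S]
    and [K * S]. *)
Lemma deviation_bound (R : realFieldType) (P Q S K m : R) :
  1 <= K -> 1 <= S -> 1 <= m -> K + 1 <= Q ->
  (Q - m * S) / m <= (Q - 1) * P <= (Q - m * S) / m + K * S ->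
  `|P - m^-1| <= (K + 1) * S / Q.
Proof.
move=> k1 s1 m1 kQ.
have m0 : 0 < m by lra.
rewrite (_ : (Q - m * S) / m = Q * m^-1 - S); last by field; lra.
have : m^-1 <= 1 by rewrite invf_le1.
have : 0 < m^-1 by rewrite invr_gt0.
move: m^-1 => t t0 t1 /andP[lo hi].
have Q1 : 0 < Q - 1 by lra.
(* Replacing the denominator [Q - 1] by [Q] costs a factor [Q / (Q - 1)], which is at most
   [(K + 1) / K] since [K + 1 <= Q]. *)
have KSQ : K * S * Q <= (K + 1) * S * (Q - 1).
  have : 0 <= S * (Q - (K + 1)) by apply: mulr_ge0; lra.
  lra.
have SQ : S * Q <= (K + 1) * S * (Q - 1).
  have : 0 <= S * (Q - 2) by apply: mulr_ge0; lra.
  have : 0 <= S * ((K - 1) * (Q - 1)) by rewrite !mulr_ge0 ?subr_ge0 //; lra.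
  lra.
rewrite ler_norml ler_pdivlMr; last by lra.
rewrite -mulNr ler_pdivrMr; last by lra.
have E : (P - t) * Q * (Q - 1) = Q * ((Q - 1) * P - (Q - 1) * t) by ring.
apply/andP; split; rewrite -(ler_pM2r Q1) E.
  apply: (@le_trans _ _ (Q * (- S))).
    by rewrite !mulNr mulrN lerN2 mulrC.
  by rewrite ler_pM2l; lra.
apply: (@le_trans _ _ (Q * (K * S))); last by rewrite mulrC.
by rewrite ler_pM2l; lra.
Qed.

Theorem theorem1p10 (F : finFieldType) (p : nat) (n k : nat) (a : nat -> F) :
  prime p -> p \in [pchar F] ->
  (1 <= k)%N -> (k <= n)%N ->
  `| probGL (trace_event n p k a)
     - 1 / ((#|F| ^ (k - k %/ p))%N)%:R |
  <= (((k + 1) * #|F| ^ (k %/ p))%N)%:R / ((#|F| ^ n)%N)%:R.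
Proof.
move=> pp pF k1 kn; have q1 := finNzRing_gt1 F.
have := shift_ratio_bounds pp pF a kn; rewrite (shift_ratio_top pp pF a kn) -probGL_trace.
have kQ : (k + 1 <= #|F| ^ n)%N.
  rewrite addn1; apply: leq_ltn_trans kn _; exact: ltn_expl.
have qk : (#|F| ^ k = #|F| ^ (k - k %/ p) * #|F| ^ (k %/ p))%N.
  by rewrite -expnD subnK // leq_div.
have qkn : (#|F| ^ k <= #|F| ^ n)%N by rewrite leq_exp2l.
have s1 : (1 <= #|F| ^ (k %/ p))%N by rewrite expn_gt0 (ltnW q1).
have m1 : (1 <= #|F| ^ (k - k %/ p))%N by rewrite expn_gt0 (ltnW q1).
have Q1 : (1 <= #|F| ^ n)%N by rewrite expn_gt0 (ltnW q1).
rewrite div1r (natrB _ qkn) (natrB _ Q1) qk !natrM natrD => bounds.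
apply: deviation_bound bounds; rewrite ?ler1n //.
by rewrite -(natrD _ k 1) ler_nat.
Qed.
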